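(* $\mathcal{SP}_{\mathbb{Z}} = \mathcal{P}_{\mathbb{Z}}$. That is, for every function $f : \mathbb{N}_+ \to \mathbb{N}_+$ given by a polynomial with coefficients in $\mathbb{Z}$, there exists a function $g : \mathbb{N}_+ \to \mathbb{N}_+$ given by a polynomial with coefficients in $\mathbb{Q}$ such that for all $n \in \mathbb{N}_+$, $$f(1) + f(2) + f(3) + \cdots + f(n) = g(n).$$
   Context: $\mathbb{N}_+ = \{1, 2, 3, \ldots\}$. $\mathcal{P}_{\mathbb{Z}}$ denotes the set of all functions $f : \mathbb{N}_+ \to \mathbb{N}_+$ given by (one-variable) polynomials with coefficients in $\mathbb{Z}$, i.e. $f(n) = p(n)$ for all $n \in \mathbb{N}_+$ for some $p \in \mathbb{Z}[x]$. $\mathcal{P}_{\mathbb{Q}}$ denotes the set of all functions $g : \mathbb{N}_+ \to \mathbb{N}_+$ given by (one-variable) polynomials with coefficients in $\mathbb{Q}$, i.e. $g(n) = q(n)$ for all $n \in \mathbb{N}_+$ for some $q \in \mathbb{Q}[x]$. $\mathcal{SP}_{\mathbb{Z}}$ denotes the subset of all $f \in \mathcal{P}_{\mathbb{Z}}$ for which there exists $g \in \mathcal{P}_{\mathbb{Q}}$ such that $f(1) + f(2) + \cdots + f(n) = g(n)$ for all $n \in \mathbb{N}_+$. *)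

(* Defs.v *)
From mathcomp Require Import all_boot all_order all_algebra.
From mathcomp Require Import classical_sets.
Set Implicit Arguments.
Unset Strict Implicit.
Unset Printing Implicit Defensive.
Import GRing.Theory.
Local Open Scope classical_set_scope.
Local Open Scope ring_scope.

Definition posnat := {n : nat | (0 < n)%N}.

Definition pos_succ (i : nat) : posnat := exist _ i.+1 (ltn0Sn i).

Definition PZ : set (posnat -> posnat) :=
  [set f | exists p : {poly int},
    forall n : posnat, (val (f n))%:R = p.[(val n)%:R]].

Definition PQ : set (posnat -> posnat) :=
  [set g | exists q : {poly rat},
    forall n : posnat, (val (g n))%:R = q.[(val n)%:R]].

(* The index i runs over 0, ..., n - 1, so the sum is f(1) + ... + f(n). *)
Definition SPZ : set (posnat -> posnat) :=
  [set f | PZ f /\ exists2 g, PQ g &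
    forall n : posnat,
      (\sum_(i < val n) val (f (pos_succ i)))%N = val (g n)].

(* Main.v *)
(** The difference operator q(x) |-> q(x + 1) - q(x) is surjective on polynomials
    over a field of characteristic 0: it sends x^(n+1) / (n+1) to x^n up to lower
    degree terms, so an antidifference is built degree by degree. Summing p over
    1, ..., n then telescopes to a polynomial in n. *)
Require Import Defs.
From mathcomp Require Import all_boot all_order all_algebra.
From mathcomp Require Import classical_sets.
Import GRing.Theory Num.Theory.
Local Open Scope ring_scope.

Lemma diff_polyXn (R : comNzRingType) (n : nat) :
  'X^n \Po ('X + 1) - 'X^n = \sum_(i < n) ('X^i *+ 'C(n, i)) :> {poly R}.
Proof.
by rewrite comp_Xn_poly addrC exprD1n big_ord_recr /= binn mulr1n addrC addrK.
Qed.

(** The binomial expansion stops at ['X^n], with coefficient ['C(n.+1, n)], which is [n.+1]. *)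
Lemma coef_diff_polyXn (R : comNzRingType) (n j : nat) :
  (n <= j)%N ->
  ('X^(n.+1) \Po ('X + 1) - 'X^(n.+1) : {poly R})`_j = n.+1%:R *+ (j == n).
Proof.
move=> le_nj; rewrite diff_polyXn coef_sum big_ord_recr /=.
rewrite coefMn coefXn binSn big1 ?add0r => [|i _].
  by rewrite mulrnAC.
by rewrite coefMn coefXn gtn_eqF ?mul0rn // (leq_trans (ltn_ord i)).
Qed.

Lemma poly_antidifference (R : numFieldType) (p : {poly R}) :
  exists q : {poly R}, q \Po ('X + 1) - q = p.
Proof.
(* Induction on a bound, since cancelling the top term may lower the size by more than one. *)
have [n] : exists n, (size p <= n)%N by exists (size p).
elim: n p => [|n IHn] p le_pn.
  by exists 0; rewrite comp_poly0 subrr; apply/esym/eqP; rewrite -size_poly_leq0.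
set r := (p`_n / n.+1%:R) *: 'X^(n.+1).
have [|q Dq] := IHn (p - (r \Po ('X + 1) - r)).
  apply/leq_sizeP => j le_nj.
  rewrite /r comp_polyZ -scalerBr coefB coefZ coef_diff_polyXn //.
  case: eqVneq => [->|ne_jn]; first by rewrite divfK ?subrr ?pnatr_eq0.
  by rewrite mulr0 subr0 nth_default // (leq_trans le_pn) // ltn_neqAle eq_sym ne_jn.
by exists (q + r); rewrite comp_polyD opprD addrACA Dq subrK.
Qed.

Lemma poly_sum (R : numFieldType) (p : {poly R}) :
  exists q : {poly R}, forall n : nat, \sum_(i < n) p.[i.+1%:R] = q.[n%:R].
Proof.
(* The shift of [p] matches summation from 1: q(i + 1) - q(i) = p(i + 1). The sum telescopes to q(n)
   - q(0). *)
have [q Dq] := poly_antidifference R (p \Po ('X + 1)).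
exists (q - q.[0]%:P) => n; rewrite hornerD hornerN hornerC.
rewrite -[RHS](telescope_sumr (fun i => q.[i%:R]) (leq0n n)) big_mkord.
apply: eq_bigr => i _; have /(congr1 (fun s : {poly R} => s.[i%:R])) := Dq.
by rewrite hornerD hornerN !horner_comp !hornerE natr1 => <-.
Qed.

Theorem mainTheorem1 : SPZ = PZ.
Proof.
rewrite eqEsubset; split=> [f []//|f [p Dp]]; split; first by exists p.
pose S (n : posnat) := (\sum_(i < val n) val (f (pos_succ i)))%N.
have S_gt0 n : (0 < S n)%N.
  (* The first term f(1) is already positive. *)
  by case: n => -[//|n] n_gt0; rewrite /S big_ord_recl ltn_addr // (valP (f _)).
exists (fun n => exist _ (S n) (S_gt0 n)) => //.
have [q Dq] := poly_sum _ (map_poly intr p : {poly rat}).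
exists q => n; rewrite -Dq /= natr_sum; apply: eq_bigr => i _.
(* The evaluation point is cast through [int], so that [intr] commutes with evaluating [p]. *)
by rewrite -[_%:R in RHS](rmorph_nat intr) horner_map /= -(Dp (pos_succ i)) rmorph_nat.
Qed.
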